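(* Let $X_1,X_2,\dots,X_n$ be i.i.d. real random variables. Fix $q$ with $0<q<1$ and let $q^*=2-q$. Assume $\mathbb{E}\exp_{q^*}(aX_1)$ is finite for small positive $a$. For $a>0$ with $0<\mathbb{E}\exp_{q^*}(aX_1)<\infty$ let $\theta(a)=\left[\mathbb{E}\exp_{q^*}(aX_1)\right]^{1-q}a$ (a strictly increasing function of $a$), let $\overline\theta=\sup_{a>0}\theta(a)\le+\infty$, and for $0<\theta<\overline\theta$ define $\Phi(\theta)=\ln_q\mathbb{E}\exp_{q^*}(aX_1)$, where $a$ is the value with $\theta(a)=\theta$. Then for all $x$, $$\mathrm{Prob}\left(\frac1n\sum_{k=1}^nX_k\ge x\right)\le\left[\exp_q(-I(x))\right]^n,$$ where $$I(x)=\sup_{0<\theta<\overline\theta}\{\theta x-\Phi(\theta)\}.$$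
   Context: For $q\in(0,2)$, $q\ne1$: $\ln_q(u)=\frac{1}{1-q}(u^{1-q}-1)$ for $u>0$, and $\exp_q(u)=[1+(1-q)u]_+^{1/(1-q)}$ for real $u$ (value in $[0,+\infty]$), where $[u]_+=\max(u,0)$. *)

(* Defs.v *)
From HB Require Import structures.
From mathcomp Require Import all_boot all_order all_algebra.
From mathcomp Require Import all_classical all_reals all_analysis.
Import Order.TTheory GRing.Theory Num.Theory.
Import numFieldNormedType.Exports.

Set Implicit Arguments.
Unset Strict Implicit.
Unset Printing Implicit Defensive.

Local Open Scope classical_set_scope.
Local Open Scope ring_scope.

Section qdefs.
Context {R : realType}.

Definition lnq (q u : R) : R := (u `^ (1 - q) - 1) / (1 - q).

(* exp_q(u) = [1 + (1-q) u]_+ ^ (1/(1-q)), with value in [0, +oo]: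
   when the base is 0 the value is 0 if q < 1 (positive exponent)
   and +oo if q > 1 (negative exponent). *)
Definition expq (q u : R) : \bar R :=
  let b := Num.max (1 + (1 - q) * u) 0 in
  if b == 0 then (if q < 1 then 0%E else +oo%E) else (b `^ (1 / (1 - q)))%:E.

(* extension of exp_q (for 0 < q < 1) to extended reals by its limits:
   exp_q(-oo) = 0, exp_q(+oo) = +oo *)
Definition expq_ext (q : R) (y : \bar R) : \bar R :=
  match y with
  | r%:E => expq q r
  | +oo%E => +oo%E
  | -oo%E => 0%E
  end.

End qdefs.

Section prob.
Context {R : realType} {d : measure_display} {T : measurableType d}.
Variable P : probability T R.

Definition iid_upto (X : nat -> {RV P >-> R}) (n : nat) : Prop :=
  (forall B : nat -> set R, (forall k, measurable (B k)) ->
     P (\bigcap_(k in `I_n) (X k @^-1` B k)) =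
     (\prod_(k < n) P (X k @^-1` B k))%E) /\
  (forall (k : nat) (B : set R), (k < n)%N -> measurable B ->
     P (X k @^-1` B) = P (X 0%N @^-1` B)).

Section tsallis.
Variables (Y : T -> R) (q : R).

Definition mgfq (a : R) : \bar R := (\int[P]_w expq (2 - q) (a * Y w))%E.

Definition thetaq (a : R) : R := (fine (mgfq a)) `^ (1 - q) * a.

Definition adom : set R := [set a | 0 < a /\ (0 < mgfq a < +oo)%E].

Definition theta_bar : \bar R := ereal_sup [set (thetaq a)%:E | a in adom].

Definition ainv (th : R) : R := xget 0 [set a | adom a /\ thetaq a = th].

Definition Phiq (th : R) : R := lnq q (fine (mgfq (ainv th))).

Definition Irate (x : R) : \bar R :=
  ereal_sup [set (th * x - Phiq th)%:E |
             th in [set th | (0%E < th%:E)%E /\ (th%:E < theta_bar)%E]].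

End tsallis.
End prob.

(* Main.v *)
Require Import Defs.
From HB Require Import structures.
From mathcomp Require Import all_boot all_order all_algebra.
From mathcomp Require Import all_classical all_reals all_analysis.
From mathcomp Require Import measurable_realfun ring lra.
Import Order.TTheory GRing.Theory Num.Theory.
Import numFieldNormedType.Exports.
Local Open Scope classical_set_scope.
Local Open Scope ring_scope.

(* Put s = 1 - q, so exp_{2-q} u = (1 - s u)^(-1/s), and M(a) = E exp_{2-q}(a X_1).
   If theta = theta(a) then 1 - s (theta x - Phi theta) = M(a)^s (1 - s a x), so
   the claim amounts to the Chernoff bounds P(mean >= x) <= (M(a) t^(1/s))^n for
   every t > 0 with t >= 1 - s a x. The AM-GM inequality, applied to the numbers
   1 - s a X_k, bounds prod_k exp_{2-q}(a X_k) from below by t^(-n/s) on the event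
   {mean >= x}, and by independence this product has expectation M(a)^n. Finally
   theta is continuous and tends to 0 at 0, so every theta in (0, theta_bar) is of
   the form theta(a). *)

(** * Powers with real exponents *)

Section powR_facts.
Context {R : realType}.

Lemma powRN_le (r u v : R) : 0 <= r -> 0 < u -> u <= v -> v `^ (- r) <= u `^ (- r).
Proof.
move=> r0 u0 uv; have v0 : 0 < v by exact: lt_le_trans uv.
rewrite !powRN lef_pV2 ?posrE ?powR_gt0//.
by rewrite ge0_ler_powR// nnegrE ltW.
Qed.

Lemma prod_powR (n : nat) (c : 'I_n -> R) (r : R) : (forall k, 0 <= c k) ->
  \prod_(k < n) (c k `^ r) = (\prod_(k < n) c k) `^ r.
Proof.
move=> c0.
(* The induction carries nonnegativity of the product along, since [powRM] needs it. *)
suff [_ ->] : 0 <= \prod_(k < n) c k /\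
  \prod_(k < n) (c k `^ r) = (\prod_(k < n) c k) `^ r by [].
elim/big_rec2: _ => [|k y z _ [y0 ->]]; first by rewrite powR1.
by split; [exact: mulr_ge0|rewrite powRM].
Qed.

Lemma powR_continuous_at (r u : R) : 0 < u -> {for u, continuous (@powR R ^~ r)}.
Proof.
move=> u0; apply/differentiable_continuous; rewrite -derivable1_diffP.
by apply: derivable_powR; rewrite in_itv/= u0.
Qed.

End powR_facts.

Lemma expey {R : realDomainType} (n : nat) : (0 < n)%N -> (+oo ^+ n = +oo :> \bar R)%E.
Proof. by case: n => // n _; elim: n => // n IH; rewrite expeS IH mulyy. Qed.

(** * Pulling a constant conditional mean out of an integral *)

Section factorization.
Local Open Scope ereal_scope.
Context {R : realType} {d : measure_display} {T : measurableType d}.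
Variable P : probability T R.
Import HBNNSimple.

(** The hypothesis says that [g] has conditional mean [c] given [Y]. It settles indicators of events
    of [Y]; linearity extends this to simple functions of [Y], and monotone convergence to every
    nonnegative measurable [f]. *)
Lemma integral_mul_comp (g : T -> R) (Y : {mfun T >-> R}) (c : R) (f : R -> R) :
  measurable_fun setT g -> (forall w, 0 <= g w)%R ->
  (forall B, measurable B ->
     \int[P]_(w in Y @^-1` B) (g w)%:E = c%:E * P (Y @^-1` B)) ->
  measurable_fun setT f -> (forall u, 0 <= f u)%R ->
  \int[P]_w (g w * f (Y w))%:E = c%:E * \int[P]_w (f (Y w))%:E.
Proof.
move=> mg g0 gc mf f0.
have mfE : measurable_fun [set: R] (fun u => (f u)%:E) by exact/measurable_EFinP.
pose h := nnsfun_approx measurableT mfE.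
have hf u : (h n u)%:E @[n --> \oo] --> (f u)%:E.
  by apply: (cvg_nnsfun_approx measurableT mfE) => // y _; rewrite lee_fin.
have ndh u m n : (m <= n)%N -> (h m u <= h n u)%R.
  by move=> mn; exact/lefP/nd_nnsfun_approx.
have mh n : measurable_fun setT (fun w => h n (Y w)).
  exact: measurableT_comp.
(* The simple function is split over its level sets, and the hypothesis on [g] is applied to each
   level set pulled back by [Y]. *)
have simple n : \int[P]_w (g w * h n (Y w))%:E = c%:E * \int[P]_w (h n (Y w))%:E.
  pose E y := Y @^-1` (h n @^-1` [set y]).
  have mE y : measurable (E y).
    by rewrite /E -[X in measurable X]setTI; exact: measurable_funP.
  have hE w : h n (Y w) = (\sum_(y \in range (h n)) y * \1_(E y) w)%R.
    by rewrite fimfunE.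
  have y0 y w : 0 <= (y * \1_(E y) w)%:E.
    exact: (@nnfun_muleindic_ge0 _ _ _ (h n) y (Y w)).
  have mi y : measurable_fun setT (fun w => (y * \1_(E y) w)%:E).
    by apply/measurable_EFinP; exact: measurable_funM.
  transitivity (\int[P]_w (\sum_(y \in range (h n)) (g w)%:E * (y * \1_(E y) w)%:E)).
    apply: eq_integral => w _.
    rewrite hE EFinM -fsumEFin// ge0_mule_fsumr//.
  rewrite ge0_integral_fsum//; last 2 first.
    - by move=> y; apply: emeasurable_funM => //; exact/measurable_EFinP.
    - by move=> y w _; rewrite mule_ge0// lee_fin.
  transitivity (c%:E * \int[P]_w (\sum_(y \in range (h n)) (y * \1_(E y) w)%:E)); last first.
    by congr (_ * _); apply: eq_integral => w _; rewrite hE -fsumEFin.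
  rewrite ge0_integral_fsum// ge0_mule_fsumr; last by move=> y; exact: integral_ge0.
  apply: eq_fsbigr => y /[!inE] -[u _ <-].
  have yge0 : (0 <= h n u)%R by [].
  set y' := h n u in yge0 *.
  under eq_integral do rewrite EFinM muleCA.
  rewrite ge0_integralZl//; last 2 first.
  - by apply: emeasurable_funM; exact/measurable_EFinP.
  - by move=> w _; rewrite -EFinM lee_fin mulr_ge0.
  under [in RHS]eq_integral do rewrite EFinM.
  rewrite ge0_integralZl//; last exact/measurable_EFinP.
  rewrite integral_indic// setIT.
  rewrite (eq_integral ((EFin \o g) \_ (E y'))); last first.
    by move=> w _; rewrite epatch_indic.
  rewrite -integral_mkcondr setTI muleCA; congr (_ * _).
  have mhy : measurable (h n @^-1` [set y']).
    by rewrite -[X in measurable X]setTI; exact: measurable_funP.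
  exact: gc mhy.
have cvgf : \int[P]_w (h n (Y w))%:E @[n --> \oo] --> \int[P]_w (f (Y w))%:E.
  rewrite [X in _ --> X](_ : _ = \int[P]_w limn (fun n => (h n (Y w))%:E)).
    apply: cvg_monotone_convergence => //.
    - by move=> n; exact/measurable_EFinP.
    - by move=> n w _; rewrite lee_fin.
    - by move=> w _ m n mn; rewrite lee_fin ndh.
  by apply: eq_integral => w _; apply/esym/cvg_lim.
have cvggf : \int[P]_w (g w * h n (Y w))%:E @[n --> \oo] --> \int[P]_w (g w * f (Y w))%:E.
  rewrite [X in _ --> X](_ : _ = \int[P]_w limn (fun n => (g w * h n (Y w))%:E)).
    apply: cvg_monotone_convergence => //.
    - by move=> n; apply/measurable_EFinP; exact: measurable_funM.
    - by move=> n w _; rewrite lee_fin mulr_ge0.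
    - by move=> w _ m n mn; rewrite lee_fin ler_wpM2l// ndh.
  apply: eq_integral => w _; apply/esym/cvg_lim => //.
  under eq_fun do rewrite EFinM.
  by rewrite EFinM; apply: cvgeZl.
move: cvggf; rewrite (_ : (fun n => _) = (fun n => c%:E * \int[P]_w (h n (Y w))%:E)).
  by move=> cvggf; apply: (cvg_unique _ cvggf) => //; exact: cvgeZl.
exact/funext.
Qed.
End factorization.

(** * Expectations under independence and identical distribution *)

Section independence.
Local Open Scope ereal_scope.
Context {R : realType} {d : measure_display} {T : measurableType d}.
Variable P : probability T R.
Variables (X : nat -> {RV P >-> R}) (n : nat).
Hypothesis iidX : iid_upto X n.

Lemma measurable_RV_preimage (k : nat) (B : set R) :
  measurable B -> measurable (X k @^-1` B).
Proof.
by move=> mB; rewrite -[X in measurable X]setTI; exact: measurable_funP.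
Qed.

(** Each side is an integral against the law of its variable, and the laws agree. *)
Lemma iid_integral_comp (f : R -> \bar R) (k : nat) : (k < n)%N ->
  measurable_fun setT f -> (forall u, 0 <= f u) ->
  \int[P]_w f (X k w) = \int[P]_w f (X 0%N w).
Proof.
move=> kn mf f0.
have push j : \int[P]_w f (X j w) = \int[pushforward P (X j)]_u f u.
  by rewrite ge0_integral_pushforward// => u _; exact: f0.
rewrite !push; apply: eq_measure_integral => A mA _.
exact: iidX.2.
Qed.

Lemma iid_integral_prod (f : nat -> R -> R) :
  (forall k, measurable_fun setT (f k)) -> (forall k u, (0 <= f k u)%R) ->
  (forall k, (k < n)%N -> \int[P]_w (f k (X k w))%:E < +oo) ->
  \int[P]_w (\prod_(k < n) f k (X k w))%R%:E =
  (\prod_(k < n) fine (\int[P]_w (f k (X k w))%:E))%R%:E.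
Proof.
move=> mf f0 foo.
pose e k := fine (\int[P]_w (f k (X k w))%:E).
have eE k : (k < n)%N -> \int[P]_w (f k (X k w))%:E = (e k)%:E.
  move=> kn; rewrite /e fineK// ge0_fin_numE; first exact: foo.
  by apply: integral_ge0 => w _; rewrite lee_fin.
have mG m : measurable_fun setT (fun w => \prod_(k < m) f k (X k w))%R.
  by apply: measurable_prod => k _; exact: measurableT_comp.
have G0 m w : (0 <= \prod_(k < m) f k (X k w))%R by exact: prodr_ge0.
have mS (B : nat -> set R) : (forall k, measurable (B k)) ->
    measurable (\bigcap_(k in `I_n) (X k @^-1` B k)).
  by move=> mB; apply: bigcap_measurableType => k _; exact: measurable_RV_preimage.
have PS (B : nat -> set R) : (forall k, measurable (B k)) ->
    P (\bigcap_(k in `I_n) (X k @^-1` B k)) = \prod_(k < n) P (X k @^-1` B k).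
  exact: iidX.1.
(* Independence lets the indicators of the events [X k \in B k] be traded one at
   a time for the factors [f k (X k)]. *)
have step m : (m <= n)%N -> forall B : nat -> set R,
    (forall k, measurable (B k)) -> (forall k, (k < m)%N -> B k = setT) ->
    \int[P]_(w in \bigcap_(k in `I_n) (X k @^-1` B k))
      (\prod_(k < m) f k (X k w))%R%:E =
    (\prod_(k < m) e k)%R%:E * \prod_(k < n) P (X k @^-1` B k).
  elim: m => [|m IH] mn B mB BT.
    under eq_integral do rewrite big_ord0.
    rewrite integral_cst ?big_ord0 ?mul1e//; last exact: mS.
    exact: PS.
  set A := \bigcap_(k in `I_n) (X k @^-1` B k).
  have mA : measurable A by exact: mS.
  have prodD1 (C : nat -> set R) : \prod_(k < n) P (X k @^-1` C k) =
      P (X m @^-1` C m) * \prod_(k < n | k != Ordinal mn) P (X k @^-1` C k).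
    by rewrite (bigD1 (Ordinal mn)).
  have pfin (C : nat -> set R) : (forall k, measurable (C k)) ->
      \prod_(k < n) P (X k @^-1` C k) \is a fin_num.
    by move=> mC; rewrite -PS//; exact: fin_num_measure (mS _ mC).
  pose c := (\prod_(k < m) e k * fine (\prod_(k < n) P (X k @^-1` B k)))%R.
  have cE : c%:E = (\prod_(k < m) e k)%R%:E * \prod_(k < n) P (X k @^-1` B k).
    by rewrite /c EFinM fineK// pfin.
  transitivity (\int[P]_w ((\prod_(k < m) f k (X k w)) * \1_A w * f m (X m w))%:E).
    rewrite integral_mkcond; apply: eq_integral => w _.
    rewrite patchE indicE big_ord_recr/=.
    by case: ifPn => _; rewrite ?mulr1// mulr0 mul0r.
  (* Since [B m] is the whole line, [A] does not constrain [X m], so the weight made of the first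
     [m] factors and [\1_A] should average to [c] on every event of [X m]. *)
  rewrite (@integral_mul_comp _ _ _ P
    (fun w => (\prod_(k < m) f k (X k w)) * \1_A w)%R (X m) c (f m))//.
  - rewrite eE// cE big_ord_recr/= EFinM.
    by rewrite muleAC.
  - by apply: measurable_funM => //; exact: mG.
  - by move=> w; rewrite mulr_ge0.
  - move=> B' mB'.
    (* Putting [B'] in slot [m] keeps the event a rectangle, still trivial in the slots below [m],
       so the induction hypothesis applies. *)
    pose C k := if k == m then B' else B k.
    have mC k : measurable (C k) by rewrite /C; case: ifP.
    have -> : \int[P]_(w in X m @^-1` B') ((\prod_(k < m) f k (X k w)) * \1_A w)%R%:E =
        \int[P]_(w in \bigcap_(k in `I_n) (X k @^-1` C k)) (\prod_(k < m) f k (X k w))%R%:E.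
      have -> : \bigcap_(k in `I_n) (X k @^-1` C k) = X m @^-1` B' `&` A.
        apply/seteqP; split=> w.
          move=> wC; split; first by have := wC m mn; rewrite /C /= eqxx.
          move=> k kn; have := wC k kn; rewrite /C /=.
          by case: eqP => // -> _; rewrite BT.
        move=> [wB' wA] k kn; rewrite /C /=.
        by case: eqP => [->//|_]; exact: wA.
      rewrite integral_mkcondr; apply: eq_integral => w _.
      rewrite patchE indicE.
      by case: ifPn => _; rewrite ?mulr1// mulr0.
    rewrite IH//; last 2 first.
    + exact: ltnW.
    + move=> k km; rewrite /C ltn_eqF// BT//.
      exact: ltnW.
    rewrite cE -muleA; congr (_ * _).
    rewrite (prodD1 C) (prodD1 B) {1}/C eqxx BT// preimage_setT probability_setT mul1e muleC.
    congr (_ * _); apply: eq_bigr => k km.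
    by rewrite /C ifN.
have := step n (leqnn n) (fun=> setT) (fun=> measurableT) (fun _ _ => erefl).
rewrite [X in _ * X]big1 ?mule1; last first.
  by move=> k _; rewrite preimage_setT; exact: probability_setT.
move=> <-; congr (integral _ _ _); apply/esym/seteqP; split => // w _ k _ //.
Qed.
End independence.

(** * Closed forms of the q-exponential and the AM-GM bound *)

Lemma expqE {R : realType} (q u : R) : expq q u =
  if 0 < 1 + (1 - q) * u then ((1 + (1 - q) * u) `^ (1 / (1 - q)))%:E
  else if q < 1 then 0%E else +oo%E.
Proof.
(* Abstracts the let-bound base, so that either value of the maximum can be substituted for it. *)
have cases (b : R) : expq q u = (if b == 0 then if q < 1 then 0%E else +oo%E
    else (b `^ (1 / (1 - q)))%:E) \/ b <> Num.max (1 + (1 - q) * u) 0.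
  by have [->|/eqP] := eqVneq b (Num.max (1 + (1 - q) * u) 0); [left|right].
have [b0|b0] := ltP 0 (1 + (1 - q) * u).
  have [->|] := cases (1 + (1 - q) * u); first by rewrite gt_eqF.
  by rewrite max_l// ltW.
have [->|] := cases 0; first by rewrite eqxx.
by rewrite max_r.
Qed.

Section dual_exponential.
Context {R : realType}.
Variable q : R.
Hypothesis q01 : 0 < q < 1.

Lemma expq_dualE (u : R) : expq (2 - q) u =
  if 0 < 1 - (1 - q) * u then ((1 - (1 - q) * u) `^ (- (1 - q)^-1))%:E else +oo%E.
Proof.
have [q0 q1] := andP q01.
have qE : 1 - (2 - q) = - (1 - q) by ring.
rewrite expqE qE mulNr invrN mulrN mul1r; case: ifP => // _.
by rewrite ltNge (_ : 1 <= 2 - q)//; lra.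
Qed.

Lemma expq_dual_ge0 (u : R) : (0 <= expq (2 - q) u)%E.
Proof. by rewrite expq_dualE; case: ifP => // _; rewrite lee_fin powR_ge0. Qed.

Lemma measurable_expq_dual : measurable_fun [set: R] (expq (2 - q) : R -> \bar R).
Proof.
have -> : (expq (2 - q) : R -> \bar R) = fun u =>
    if 0 < 1 - (1 - q) * u then ((1 - (1 - q) * u) `^ (- (1 - q)^-1))%:E else +oo%E.
  by apply/funext => u; exact: expq_dualE.
have ml : measurable_fun [set: R] (fun u : R => 1 - (1 - q) * u).
  by apply: measurable_funB => //; exact: measurable_funM.
apply: measurable_fun_ifT => //; first exact: measurable_fun_ltr.
apply/measurable_EFinP.
exact: (@measurableT_comp _ _ _ _ _ _ (@powR R ^~ (- (1 - q)^-1))).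
Qed.

(* AM-GM: the product of the [1 - (1 - q) a u_k] is at most the n-th power of
   their mean. *)
Lemma prod_expq_dual_ge (n : nat) (u : nat -> R) (a x t : R) :
  (0 < n)%N -> 0 < a -> 0 < t -> 1 - (1 - q) * (a * x) <= t ->
  x <= (\sum_(k < n) u k) / n%:R ->
  (forall k, (k < n)%N -> expq (2 - q) (a * u k) \is a fin_num) ->
  ((t `^ ((1 - q)^-1)) ^+ n)^-1 <= \prod_(k < n) fine (expq (2 - q) (a * u k)).
Proof.
move=> n0 a0 t0 xt xu ufin.
have [q0 q1] := andP q01.
have s0 : 0 < 1 - q by lra.
pose c k := 1 - (1 - q) * (a * u k).
(* A nonpositive base would give the value +oo, against finiteness. *)
have c0 k : (k < n)%N -> 0 < c k.
  by move=> /ufin; rewrite expq_dualE -/(c k); case: ltP.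
rewrite (eq_bigr (fun k : 'I_n => c k `^ (- (1 - q)^-1))); last first.
  by move=> k _; rewrite expq_dualE -/(c k) c0.
rewrite prod_powR; last by move=> k; exact/ltW/c0.
rewrite powRN -powR_mulrn ?powR_ge0// powRAC powR_mulrn ?(ltW t0)//.
have prodc0 : 0 < \prod_(k < n) c k by apply: prodr_gt0 => k _; exact: c0.
have nR0 : n%:R != 0 :> R by rewrite pnatr_eq0 -lt0n.
(* The base is affine and decreasing in u, so the mean of the [c k] is the base at the mean of the
   [u k], hence at most the base at [x]. *)
have mean : (\sum_(k < n) c k) / n%:R <= t.
  apply: le_trans xt.
  rewrite /c big_split/= sumr_const card_ord sumrN -mulr_sumr -mulr_sumr.
  rewrite -[1 *+ n]/(n%:R) mulrDl divff// mulNr -!mulrA.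
  by rewrite lerD2l lerN2 ler_pM2l// ler_pM2l.
have mean0 : 0 <= (\sum_(k < n) c k) / n%:R.
  by rewrite divr_ge0// sumr_ge0// => k _; exact/ltW/c0.
have amgm : \prod_(k < n) c k <= t ^+ n.
  have := @leif_AGM R 'I_n predT (fun k => c k) (fun k _ => ltW (c0 k (ltn_ord k))).
  rewrite card_ord => -[+ _] => /le_trans; apply.
  by rewrite lerXn2r// nnegrE// ltW.
rewrite lef_pV2 ?posrE ?powR_gt0// ?exprn_gt0//.
by rewrite ge0_ler_powR// ?nnegrE ?invr_ge0 ?exprn_ge0// ltW.
Qed.

End dual_exponential.

(** * The Chernoff bound for a fixed a *)

Section tail.
Local Open Scope ereal_scope.
Context {R : realType} {d : measure_display} {T : measurableType d}.
Variable P : probability T R.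
Variables (X : nat -> {RV P >-> R}) (n : nat) (q : R).
Hypothesis n0 : (0 < n)%N.
Hypothesis q01 : (0 < q < 1)%R.
Hypothesis iidX : iid_upto X n.

Lemma measurable_expq_comp (Y : {RV P >-> R}) (a : R) :
  measurable_fun setT (fun w => expq (2 - q) (a * Y w)).
Proof.
apply: (@measurableT_comp _ _ _ _ _ _ (expq (2 - q) : R -> \bar R) _ (fun w => a * Y w)%R).
  exact: measurable_expq_dual.
exact: measurable_funM.
Qed.

(** A nonnegative function with finite integral is finite almost everywhere; here this means that
    the base 1 - (1 - q) a Y is almost surely positive. *)
Lemma mgfq_ae_fin_num (Y : {RV P >-> R}) (a : R) : mgfq P Y q a < +oo ->
  {ae P, forall w, expq (2 - q) (a * Y w) \is a fin_num}.
Proof.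
move=> Moo.
have : P.-integrable setT (fun w => expq (2 - q) (a * Y w)).
  apply/integrableP; split; first exact: measurable_expq_comp.
  under eq_integral do rewrite gee0_abs ?expq_dual_ge0//.
  exact: Moo.
move=> /(integrable_ae measurableT).
by apply: filterS => w; exact.
Qed.

Lemma measurable_mean_ge (x : R) :
  measurable [set w | (x <= (\sum_(k < n) X k w) / n%:R)%R].
Proof.
have mm : measurable_fun setT (fun w => (\sum_(k < n) X k w) / n%:R)%R.
  apply: measurable_funM => //.
  exact: (@measurable_sum _ _ _ setT _ _ (fun (k : 'I_n) w => X k w)).
by rewrite -[X in measurable X]setTI; apply: (measurable_fun_le measurableT).
Qed.

(** Markov's inequality for the product of the q-exponentials. The level [t] is left free because 1
    - (1 - q) a x is not known to be positive. *)
Lemma mean_tail_le (a x t : R) :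
  (0 < a)%R -> mgfq P (X 0%N) q a < +oo ->
  (0 < t)%R -> (1 - (1 - q) * (a * x) <= t)%R ->
  P [set w | (x <= (\sum_(k < n) X k w) / n%:R)%R] <=
  ((fine (mgfq P (X 0%N) q a) * t `^ ((1 - q)^-1)) ^+ n)%:E.
Proof.
move=> a0 Moo t0 xt.
set A := [set w | _]; set M := fine _; set tau := (t `^ _)%R.
have tau0 : (0 < tau ^+ n)%R by rewrite exprn_gt0// powR_gt0.
(* [fine] sends +oo to 0, so [f] matches the q-exponential only where that is finite, which is
   almost surely along each [X k] with k < n. *)
pose f u := fine (expq (2 - q) (a * u)%R).
have mF : measurable_fun [set: R] (fun u : R => expq (2 - q) (a * u)%R).
  apply: (@measurableT_comp _ _ _ _ _ _ (expq (2 - q) : R -> \bar R) _ (fun u => a * u)%R).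
    exact: measurable_expq_dual.
  exact: measurable_funM.
have mf : measurable_fun [set: R] f.
  exact: (@measurableT_comp _ _ _ _ _ _ (@fine R)).
have f0 u : (0 <= f u)%R by rewrite /f fine_ge0// expq_dual_ge0.
have mgfX k : (k < n)%N -> mgfq P (X k) q a = mgfq P (X 0%N) q a.
  move=> kn; rewrite /mgfq (iid_integral_comp _ _ _ iidX _ _ kn mF)// => u.
  exact: expq_dual_ge0.
have Xfin k : (k < n)%N -> {ae P, forall w, expq (2 - q) (a * X k w) \is a fin_num}.
  by move=> kn; apply: mgfq_ae_fin_num; rewrite mgfX.
have mfX k : measurable_fun setT (fun w => f (X k w)) by exact: measurableT_comp.
have fX k : (k < n)%N -> \int[P]_w (f (X k w))%:E = mgfq P (X 0%N) q a.
  move=> kn; rewrite -(mgfX k kn); apply: ge0_ae_eq_integral => //.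
  - exact/measurable_EFinP.
  - exact: measurable_expq_comp.
  - by move=> w _; rewrite lee_fin.
  - by move=> w _; exact: expq_dual_ge0.
  - by apply: filterS (Xfin k kn) => w /fineK wfin _; exact: wfin.
have mprod : measurable_fun setT (fun w => \prod_(k < n) f (X k w))%R.
  exact: measurable_prod.
have prodE : \int[P]_w (\prod_(k < n) f (X k w))%R%:E = (M ^+ n)%:E.
  rewrite (iid_integral_prod _ _ _ iidX _ (fun=> mf) (fun=> f0)); last first.
    by move=> k kn; rewrite fX.
  congr EFin; rewrite -[in RHS](card_ord n) -prodr_const.
  by apply: eq_bigr => k _; rewrite fX.
have mA : measurable A by exact: measurable_mean_ge.
(* The pointwise inequality behind Markov's bound; it needs all n values finite at once, hence a
   countable intersection of almost sure events. *)
have Aae : {ae P, forall w, setT w ->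
    ((tau ^+ n)^-1 * \1_A w)%:E <= (\prod_(k < n) f (X k w))%:E}.
  have : {ae P, forall w k, (k < n)%N -> expq (2 - q) (a * X k w) \is a fin_num}.
    apply: ae_foralln => k; have [kn|kn] := ltnP k n; last exact: nearW.
    by apply: filterS (Xfin k kn) => w.
  apply: filterS => w wfin _; rewrite lee_fin indicE.
  have [wA|_] := boolP (w \in A); last by rewrite mulr0 prodr_ge0.
  rewrite mulr1; apply: (prod_expq_dual_ge _ q01 _ (fun k => X k w) _ _ _ n0 a0 t0 xt) => //.
  exact: set_mem wA.
have intA : \int[P]_w ((tau ^+ n)^-1 * \1_A w)%:E = ((tau ^+ n)^-1)%:E * P A.
  under eq_integral do rewrite EFinM.
  rewrite ge0_integralZl ?integral_indic ?setIT//.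
  - exact/measurable_EFinP.
  - by rewrite lee_fin invr_ge0 ltW.
have : ((tau ^+ n)^-1)%:E * P A <= (M ^+ n)%:E.
  rewrite -intA -prodE; apply: ae_ge0_le_integral => //.
  - by move=> w _; rewrite lee_fin mulr_ge0// invr_ge0 ltW.
  - by apply/measurable_EFinP; exact: measurable_funM.
  - by move=> w _; rewrite lee_fin prodr_ge0.
  - exact/measurable_EFinP.
have /fineK <- : P A \is a fin_num by exact: fin_num_measure.
rewrite -EFinM !lee_fin exprMn => H.
by rewrite -ler_pdivrMr// mulrC.
Qed.

End tail.

(** * Continuity of theta and its range *)

Section attained.
Context {R : realType} {d : measure_display} {T : measurableType d}.
Variable P : probability T R.
Variables (Y : {RV P >-> R}) (q : R).
Hypothesis q01 : 0 < q < 1.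

(** The dual q-exponential never vanishes, so a zero integral would make the whole space a null
    set. *)
Lemma mgfq_gt0 (a : R) : (0 < mgfq P Y q a)%E.
Proof.
have mE : measurable_fun setT (fun w => expq (2 - q) (a * Y w)).
  exact: measurable_expq_comp.
rewrite lt_neqAle integral_ge0 ?andbT; last by move=> w _; exact: expq_dual_ge0.
apply/eqP => M0.
have : (\int[P]_w `|expq (2 - q) (a * Y w)| = 0)%E.
  by rewrite M0; apply: eq_integral => w _; rewrite gee0_abs ?expq_dual_ge0.
move=> /(ae_eq_integral_abs _ measurableT mE)[N [mN N0 EN]].
have NT : N = setT.
  apply/seteqP; split=> // w _; apply: EN => /= /(_ Logic.I).
  rewrite expq_dualE//; case: ltP => // c0 -[] /eqP.
  by rewrite gt_eqF// powR_gt0.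
have := @probability_setT _ _ _ P; rewrite -NT => /(etrans (esym N0))[] /eqP.
by rewrite eq_sym oner_eq0.
Qed.

(* Retracts the line onto [0, a0]: the domain of finiteness of mgfq may end at a0,
   while continuity_under_integral needs an open interval around [0, a0]. *)
Definition clamp (a0 a : R) : R := (`|a| + a0 - `| `|a| - a0 |) / 2.

Lemma clamp_id a0 a : 0 <= a <= a0 -> clamp a0 a = a.
Proof.
move=> /andP[a_ge0 aa0]; rewrite /clamp ger0_norm// ler0_norm ?subr_le0//; lra.
Qed.

Lemma clamp_itv a0 a : 0 <= a0 -> 0 <= clamp a0 a <= a0.
Proof.
move=> a00; have := normr_ge0 a; rewrite /clamp; set b := `|a| => b0.
by have [ba|ab] := leP b a0;
  [rewrite ler0_norm ?subr_le0//|rewrite gtr0_norm ?subr_gt0//]; apply/andP; split; lra.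
Qed.

(** The formula is min(|a|, a0) written with absolute values, so continuity comes from that of the
    norm. *)
Lemma clamp_continuous a0 : continuous (clamp a0).
Proof.
move=> a; rewrite /clamp.
have cn (b : R) : (fun x : R => `|x|) x @[x --> b] --> (fun x : R => `|x|) b.
  exact: norm_continuous.
apply: cvgM; last exact: cvg_cst.
apply: (@cvgB _ R^o).
  by apply: (@cvgD _ R^o); [exact: cn|exact: cvg_cst].
apply: (@cvg_norm _ R^o).
by apply: (@cvgB _ R^o); [exact: cn|exact: cvg_cst].
Qed.

(** Intermediate value theorem on [0, a0], where theta starts at 0 and ends above [th]; continuity
    comes from dominated convergence. *)
Lemma thetaq_attained (a0 th : R) :
  adom P Y q a0 -> 0 < th -> th < thetaq P Y q a0 ->
  exists a, adom P Y q a /\ thetaq P Y q a = th.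
Proof.
move=> [a0_gt0 /andP[_ M0oo]] th0 tha0.
have [q0 q1] := andP q01.
have s0 : 0 < 1 - q by lra.
pose c (b : R) w := 1 - (1 - q) * (b * Y w).
(* This event has full probability, and on it the base stays positive for every b in [0, a0]. *)
pose B := [set w | 0 < c a0 w].
have mc b : measurable_fun setT (c b).
  apply: measurable_funB => //; apply: measurable_funM => //.
  exact: measurable_funM.
have mB : measurable B.
  rewrite (_ : B = c a0 @^-1` `]0, +oo[%classic).
    rewrite -[X in measurable X]setTI; apply: mc => //; exact: measurable_itv.
  by apply/seteqP; split => w /=; rewrite in_itv/= andbT.
have PB : P (~` B) = 0%E.
  have [N [mN N0 BN]] := mgfq_ae_fin_num P q q01 Y a0 M0oo.
  apply: subset_measure0 N0 => //; first exact: measurableC.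
  by move=> w /= cw; apply: BN => /=; rewrite expq_dualE// -/(c a0 w); move/negP/negbTE: cw => ->.
have c_gt0 b w : 0 <= b <= a0 -> B w -> 0 < c b w.
  move=> /andP[b0 ba0]; rewrite /B /= /c => Bw.
  have [Y0|Y0] := leP 0 (Y w).
    have : b * Y w <= a0 * Y w by rewrite ler_wpM2r.
    by rewrite -(ler_pM2l s0); lra.
  have : (1 - q) * (b * Y w) <= 0.
    by rewrite pmulr_rle0// nmulr_lle0.
  by lra.
pose F b w := c b w `^ (- (1 - q)^-1).
have mF b : measurable_fun setT (F b).
  exact: (@measurableT_comp _ _ _ _ _ _ (@powR R ^~ (- (1 - q)^-1))).
have F_ge0 b w : 0 <= F b w by exact: powR_ge0.
have FE b w : 0 <= b <= a0 -> B w -> expq (2 - q) (b * Y w) = (F b w)%:E.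
  by move=> bi Bw; rewrite expq_dualE// -/(c b w) c_gt0.
have mgfF b : 0 <= b <= a0 -> mgfq P Y q b = (\int[P]_(w in B) (F b w)%:E)%E.
  move=> bi; rewrite /mgfq (@ge0_negligible_integral _ _ _ _ setT (~` B))//.
  - rewrite setTD setCK; apply: eq_integral => w /[!inE] Bw.
    exact: FE.
  - exact: measurableC.
  - exact: measurable_expq_comp.
  - by move=> w _; exact: expq_dual_ge0.
(* A dominating function uniform in b: where Y >= 0, [F b] increases with b up to [F a0]; where Y <
   0, the base is at least 1 and so [F b] is at most 1. *)
have F_le b w : 0 <= b <= a0 -> B w -> F b w <= 1 + F a0 w.
  move=> bi Bw; have [b0 ba0] := andP bi.
  have [Y0|Y0] := leP 0 (Y w).
    apply: (@le_trans _ _ (F a0 w)); last by rewrite lerDr.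
    apply: powRN_le; [by rewrite invr_ge0 ltW|exact: Bw|].
    by rewrite lerB// ler_pM2l// ler_wpM2r.
  apply: (@le_trans _ _ 1); last by rewrite lerDl.
  rewrite -[leRHS](@congr1 _ _ (fun f => f (- (1 - q)^-1)) _ _ (powR1 R)).
  apply: powRN_le => //; first by rewrite invr_ge0 ltW.
  rewrite lerBrDr gerDl.
  by rewrite pmulr_rle0// mulr_ge0_le0// ltW.
have intFa0 : P.-integrable B (EFin \o F a0).
  apply/integrableP; split.
    by apply/measurable_EFinP; exact: measurable_funTS.
  under eq_integral do rewrite /= ger0_norm//.
  by rewrite -mgfF// lexx ltW.
have intG : P.-integrable B (EFin \o (fun w => 1 + F a0 w)).
  have := integrableD mB (finite_measure_integrable_cst P 1 mB) intFa0.
  exact.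
have intF b : 0 <= b <= a0 -> P.-integrable B (EFin \o F b).
  move=> bi; apply: le_integrable intG => //.
    by apply/measurable_EFinP; exact: measurable_funTS.
  move=> w Bw /=; rewrite lee_fin !ger0_norm//.
    exact: F_le.
  by rewrite addr_ge0.
pose Mt b := (\int[P]_(w in B) F (clamp a0 b) w)%R.
have a0_ge0 : 0 <= a0 by exact: ltW.
have MtE b : 0 <= b <= a0 -> Mt b = fine (mgfq P Y q b).
  by move=> bi; rewrite (mgfF b bi) /Mt (clamp_id _ _ bi); exact: erefl.
have cMt : {in `](-1), (a0 + 1)[%classic, continuous Mt}.
  apply: (@continuity_under_integral R _ T P (fun b => F (clamp a0 b)) B mB
    (-1) (a0 + 1) _ _ (fun w => 1 + F a0 w)).
  - by move=> b _; apply: intF; exact: clamp_itv.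
  - apply: aeW => w Bw b _.
    apply: (@continuous_comp _ _ _ (fun b => c (clamp a0 b) w) (@powR R ^~ (- (1 - q)^-1))).
      rewrite /prop_for /continuous_at /c; apply: (@cvgB _ R^o); first exact: cvg_cst.
      apply: cvgM; first exact: cvg_cst.
      by apply: cvgM; [exact: clamp_continuous|exact: cvg_cst].
    by apply: powR_continuous_at; apply: c_gt0 => //; exact: clamp_itv.
  - exact: intG.
  - move=> b _; apply: aeW => w Bw.
    by rewrite ger0_norm//; apply: F_le => //; exact: clamp_itv.
have fin_mgf b : 0 <= b <= a0 -> (mgfq P Y q b < +oo)%E.
  move=> bi; rewrite mgfF//; have /integrableP[_] := intF b bi.
  by under eq_integral do rewrite /= ger0_norm//.
have Mt_gt0 b : 0 <= b <= a0 -> 0 < Mt b.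
  by move=> bi; rewrite MtE// fine_gt0// mgfq_gt0 fin_mgf.
pose thetat b := Mt b `^ (1 - q) * b.
have cth : {within `[0, a0], continuous thetat}.
  apply: continuous_in_subspaceT => b; rewrite inE/= in_itv/= => bi.
  apply: cvgM; last exact: cvg_id.
  apply: (@continuous_comp _ _ _ Mt (@powR R ^~ (1 - q))).
    apply: cMt; rewrite inE/= in_itv/=; move/andP: bi => [? ?]; apply/andP; split; lra.
  exact/powR_continuous_at/Mt_gt0.
have thE b : 0 <= b <= a0 -> thetat b = thetaq P Y q b.
  by move=> bi; rewrite /thetat MtE.
have th0E : thetat 0 = 0 by rewrite /thetat mulr0.
have tha0E : thetat a0 = thetaq P Y q a0 by rewrite thE// a0_ge0 lexx.
have [|b] := @IVT R thetat 0 a0 th a0_ge0 cth.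
  rewrite th0E tha0E ge_min le_max (ltW th0) (ltW tha0) ?orbT//.
rewrite in_itv/= => bi bth.
exists b; split; last by rewrite -thE.
split; last by rewrite mgfq_gt0 fin_mgf.
(* The point found is not 0, because theta vanishes there while [th] is positive. *)
rewrite lt_neqAle (andP bi).1 andbT; apply/eqP => b0.
by move: th0; rewrite -bth -b0 th0E ltxx.
Qed.

End attained.

(** * Passage from the Chernoff bounds to the rate function *)

Theorem theorem1 (R : realType) (d : measure_display) (T : measurableType d)
  (P : probability T R) (n : nat) (X : nat -> {RV P >-> R}) (q : R) :
  (0 < n)%N ->
  0 < q < 1 ->
  iid_upto X n ->
  (exists eps : R, 0 < eps /\
     forall a : R, 0 < a < eps -> (mgfq P (X 0%N) q a < +oo)%E) ->
  forall x : R,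
    (P [set w | (x <= (\sum_(k < n) X k w) / n%:R)%R]
       <= (expq_ext q (- Irate P (X 0%N) q x)) ^+ n)%E.
Proof.
move=> n0 q01 iidX _ x.
have [q0 q1] := andP q01.
set s := 1 - q; have s0 : 0 < s by rewrite /s; lra.
have nR0 : n%:R != 0 :> R by rewrite pnatr_eq0 -lt0n.
set A := [set w | _].
set I := Irate P (X 0%N) q x.
have expq_ext_ge0 : (0 <= expq_ext q (- I))%E.
  case: (- I)%E => //= r; rewrite expqE.
  by case: ifP => _; [rewrite lee_fin powR_ge0|case: ifP].
have [PA0|PA0] := leP (P A) 0%E; first by rewrite (le_trans PA0)// expe_ge0.
have PAfin : P A \is a fin_num by apply: fin_num_measure; exact: measurable_mean_ge.
set p := fine (P A).
have pE : P A = p%:E by rewrite fineK.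
have p0 : 0 < p by move: PA0; rewrite pE lte_fin.
(* Taking n-th roots, the goal becomes rho <= exp_q(-I), which will follow from I <= -ln_q(rho) = (1
   - rho^s) / s. *)
pose rho := p `^ (n%:R^-1).
have rho0 : 0 < rho by exact: powR_gt0.
have rhoX : rho ^+ n = p.
  by rewrite -powR_mulrn ?powR_ge0// -powRrM mulVf// powRr1 ?ltW.
have rate_le th : 0 < th -> (th%:E < theta_bar P (X 0%N) q)%E ->
    th * x - Phiq P (X 0%N) q th <= (1 - rho `^ s) / s.
  move=> th0 /ereal_sup_gt[_ [a0 a0dom <-]]; rewrite lte_fin => tha0.
  have [a1 a1P] := thetaq_attained P (X 0%N) q q01 a0 th a0dom th0 tha0.
  (* As theta is attained, [ainv] returns a genuine preimage and not its default 0. *)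
  have [] : [set a | adom P (X 0%N) q a /\ thetaq P (X 0%N) q a = th]
      (ainv P (X 0%N) q th) by apply: xgetPex; exists a1.
  rewrite /Phiq; set a := ainv _ _ _ _ => -[a_gt0 /andP[M0 Moo]] tha.
  set M := fine (mgfq P (X 0%N) q a).
  have Mgt0 : 0 < M by rewrite fine_gt0// M0.
  have -> : th * x - lnq q M = (1 - M `^ s * (1 - s * (a * x))) / s.
    rewrite -tha /thetaq -/M -/s /lnq -/s; field; exact: lt0r_neq0.
  rewrite ler_pM2r ?invr_gt0// lerB//.
  have rhoM t : 0 < t -> 1 - s * (a * x) <= t -> (rho / M) `^ s <= t.
    move=> t0 xt.
    have := mean_tail_le P X n q n0 q01 iidX a x t a_gt0 Moo t0 xt.
    rewrite -/A pE lee_fin -/M -/s -rhoX.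
    have Mt0 : 0 <= M * t `^ s^-1 by rewrite mulr_ge0 ?powR_ge0// ltW.
    rewrite ler_pXn2r// ?nnegrE ?(ltW rho0)// => rhot.
    have {}rhot : rho / M <= t `^ s^-1 by rewrite ler_pdivrMr// mulrC.
    have -> : t = (t `^ s^-1) `^ s.
      by rewrite -powRrM mulVf ?lt0r_neq0// powRr1// ltW.
    by apply: ge0_ler_powR rhot; rewrite ?nnegrE ?powR_ge0// ltW// divr_gt0.
  have rM0 : 0 < (rho / M) `^ s by rewrite powR_gt0// divr_gt0.
  (* Otherwise every t > 0 would be admissible in [rhoM], and half of the positive lower bound (rho
     / M)^s is a contradictory choice. *)
  have cx : 0 < 1 - s * (a * x).
    rewrite ltNge; apply/negP => cx.
    have half0 : 0 < (rho / M) `^ s / 2 by rewrite divr_gt0.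
    by have := rhoM _ half0 (le_trans cx (ltW half0)); lra.
  have -> : rho = M * (rho / M) by rewrite mulrC divfK// lt0r_neq0.
  rewrite powRM ?(ltW Mgt0) ?(ltW (divr_gt0 rho0 Mgt0))//.
  by rewrite ler_pM2l ?powR_gt0// rhoM.
have : (I <= ((1 - rho `^ s) / s)%:E)%E.
  apply: ge_ereal_sup => _ [th [th0 thb] <-]; rewrite lee_fin.
  by apply: rate_le.
(* The real bound excludes I = +oo. If I = -oo (supremum of the empty set), the right side is a
   power of +oo with exponent n > 0. *)
rewrite pE; case: I expq_ext_ge0 => [r| |] _ //=; last first.
  by move=> _; rewrite expey// leey.
rewrite lee_fin ler_pdivlMr// => rI.
(* The base of exp_q(-I) is thus positive, so its truncation at 0 is inactive. *)
have cr : rho `^ s <= 1 + (1 - q) * (- r) by rewrite -/s; lra.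
rewrite expqE (lt_le_trans (powR_gt0 s rho0) cr) -EFin_expe lee_fin -rhoX.
have rhoE : rho = (rho `^ s) `^ (1 / (1 - q)).
  by rewrite -powRrM mul1r divff ?lt0r_neq0// powRr1// ltW.
have cr0 : 0 <= rho `^ s by exact: powR_ge0.
apply: lerXn2r; rewrite ?nnegrE ?powR_ge0 ?(ltW rho0)// rhoE.
by apply: ge0_ler_powR; rewrite ?nnegrE ?(le_trans cr0 cr)// divr_ge0// ltW.
Qed.
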